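(* Let $d,p\in\mathbb{N}$ and let $(\mathbf{X}_n)_{n\in\mathbb{Z}}$ be a $d$-variate INAR($p$) sequence with immigration-parameter vector $\mathbf{a}_0\in\mathbb{R}_{\ge 0}^d\setminus\{0_d\}$ and reproduction-coefficient matrices $A_k\in\mathbb{R}_{\ge 0}^{d\times d}$, $k=1,\dots,p$, such that all zeros of $$z\mapsto\det\Big(z\,1_{d\times d}-\sum_{k=1}^pA_k\Big),\quad z\in\mathbb{C},$$ lie inside the unit circle. Then $$\mathbf{u}_n:=\mathbf{X}_n-\mathbf{a}_0-\sum_{k=1}^pA_k\mathbf{X}_{n-k},\quad n\in\mathbb{Z},$$ defines a (dependent) white-noise sequence, i.e., $(\mathbf{u}_n)_{n\in\mathbb{Z}}$ is stationary, $\mathbb{E}\,\mathbf{u}_n=0_d$ for all $n\in\mathbb{Z}$, and $$\mathbb{E}\big[\mathbf{u}_n\mathbf{u}_{n'}^\top\big]=\begin{cases}\operatorname{diag}\Big(\big(1_{d\times d}-\sum_{k=1}^pA_k\big)^{-1}\mathbf{a}_0\Big),&n=n',\\ 0_{d\times d},&n\neq n'.\end{cases}$$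
   Context: Notation: $1_{d\times d}$ is the $d\times d$ identity matrix, $0_d$ the zero vector in $\mathbb{R}^d$, $0_{d\times d}$ the $d\times d$ zero matrix; for a vector $v\in\mathbb{R}^d$, $\operatorname{diag}(v)$ is the diagonal matrix with diagonal $v$. Vectors are column vectors. ''Inside the unit circle'' means of modulus strictly less than $1$. Reproduction operator: for an $\mathbb{N}_0$-valued random variable $Y$ and $\alpha\ge 0$, $\alpha\circ Y:=\sum_{m=1}^{Y}\xi_m^{(\alpha)}$, where $\xi_1^{(\alpha)},\xi_2^{(\alpha)},\dots$ are i.i.d. $\mathrm{Poisson}(\alpha)$ and independent of $Y$ (with the empty sum equal to $0$). Multivariate reproduction operator: for $A=(\alpha_{i,j})\in\mathbb{R}_{\ge 0}^{d\times d}$ and an $\mathbb{N}_0^d$-valued random vector $\mathbf{X}=(X_1,\dots,X_d)^\top$, $A\circledast\mathbf{X}$ is the vector with $i$-th component $\sum_{j=1}^d\alpha_{i,j}\circ X_j$, where the reproductions $\alpha_{i,j}\circ\cdot$ operate independently over $1\le i,j\le d$. INAR($p$) sequence: let $(\boldsymbol{\varepsilon}_n)_{n\in\mathbb{Z}}$ be an i.i.d. sequence of $\mathbb{N}_0^d$-valued vectors with mutually independent components $\boldsymbol{\varepsilon}_{0,i}\sim\mathrm{Poisson}(\mathbf{a}_{0,i})$, $i=1,\dots,d$. A $d$-variate INAR($p$) sequence with immigration-parameter vector $\mathbf{a}_0$ and reproduction-coefficient matrices $A_1,\dots,A_p$ is a stationary sequence $(\mathbf{X}_n)_{n\in\mathbb{Z}}$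 of $\mathbb{N}_0^d$-valued random vectors solving $$\mathbf{X}_n=\sum_{k=1}^pA_k\circledast\mathbf{X}_{n-k}+\boldsymbol{\varepsilon}_n,\quad n\in\mathbb{Z},$$ where the operators $\circledast$ operate independently over $k$ and $n$ and independently of $(\boldsymbol{\varepsilon}_n)$. As usual, for each $n$ the immigration $\boldsymbol{\varepsilon}_n$ and the Poisson variables used in the reproductions $A_k\circledast\mathbf{X}_{n-k}$, $k=1,\dots,p$, at time $n$ are independent of the past $(\mathbf{X}_m)_{m<n}$. *)

(* Defs.v *)
From HB Require Import structures.
From mathcomp Require Import all_boot all_order all_algebra.
From mathcomp Require Import complex.
From mathcomp Require Import all_classical all_reals all_analysis.

Set Implicit Arguments.
Unset Strict Implicit.
Unset Printing Implicit Defensive.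

Import Order.TTheory GRing.Theory Num.Theory.
Import numFieldNormedType.Exports.

Local Open Scope classical_set_scope.
Local Open Scope ring_scope.

(* sigma(Y i, i in D) *)
Definition generated_sigma {d'} {E : measurableType d'} {aT I : Type}
    (D : set I) (Y : I -> aT -> E) : set_system aT :=
  <<s \bigcup_(i in D) preimage_set_system setT (Y i) measurable >>.

Section probability_notions.
Context {disp : measure_display} {T : measurableType disp} {R : realType}.
Variable P : probability T R.

Definition independent_sigma (F G : set_system T) : Prop :=
  forall A B, F A -> G B -> P (A `&` B) = (P A * P B)%E.

Definition mutually_independent {d'} {E : measurableType d'} {I : eqType}
    (Y : I -> T -> E) : Prop :=
  forall (s : seq I) (B : I -> set E), uniq s -> (forall i, measurable (B i)) ->
    P (\bigcap_(i in [set` s]) Y i @^-1` B i) =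
      (\prod_(i <- s) P (Y i @^-1` B i))%E.

(* The second argument of [poisson_prob] is unused by the library; for rate 0
   the library's law is the Dirac mass at 0, as wanted here. *)
Definition poisson_law (Y : {RV P >-> nat}) (rate : R) : Prop :=
  forall U : set nat, distribution P Y U = poisson_prob rate 0%N U.

(* Strict stationarity: for every h, the shifted process (Z (n + h))_n has the
   same law as (Z n)_n, both being laws on the path space (int * J -> E) with
   the sigma-algebra generated by the coordinates. *)
Definition stationary {d'} {E : measurableType d'} {J : Type}
    (Z : int -> J -> T -> E) : Prop :=
  forall (h : int) (B : set (int * J -> E)),
    generated_sigma setT (fun q (f : int * J -> E) => f q) B ->
    P [set w | B (fun q => Z (q.1 + h) q.2 w)] =
    P [set w | B (fun q => Z q.1 q.2 w)].

(* An entry of [expectation_mx M] can be a real number only if the corresponding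
   (measurable) entry of M is integrable, since +oo - +oo = -oo in \bar R. *)
Definition expectation_mx {m n : nat} (M : T -> 'M[R]_(m, n)) :
    'M[\bar R]_(m, n) :=
  \matrix_(i, j) expectation P (fun w => M w i j).

Definition white_noise {d : nat} (u : int -> T -> 'cV[R]_d)
    (Sigma : 'M[R]_d) : Prop :=
  [/\ stationary (fun n (i : 'I_d) w => u n w i 0),
      forall n, expectation_mx (u n) = map_mx EFin 0 &
      forall n n', expectation_mx (fun w => u n w *m (u n' w)^T) =
        map_mx EFin (if n == n' then Sigma else 0)].

End probability_notions.

Section inar.
Context {disp : measure_display} {T : measurableType disp} {R : realType}.
Variable P : probability T R.

Definition reproduction (xi : nat -> T -> nat) (Y : T -> nat) (w : T) : nat :=
  (\sum_(m < Y w) xi m w)%N.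

Definition mreproduction {d : nat} (xi : 'I_d -> 'I_d -> nat -> T -> nat)
    (Y : 'I_d -> T -> nat) (i : 'I_d) (w : T) : nat :=
  (\sum_(j < d) reproduction (xi i j) (Y j) w)%N.

(* The sources of randomness at a given time: [inl i] is the i-th component of
   the immigration, [inr (k, i, j, m)] the m-th Poisson variable used in the
   (i, j) entry of the reproduction at lag k.+1. *)
Definition noise_index (d p : nat) := ('I_d + 'I_p * 'I_d * 'I_d * nat)%type.

Definition noise {d p : nat} (eps : int -> 'I_d -> {RV P >-> nat})
    (xi : int -> 'I_p -> 'I_d -> 'I_d -> nat -> {RV P >-> nat})
    (q : int * noise_index d p) : T -> nat :=
  match q.2 with
  | inl i => eps q.1 i
  | inr (k, i, j, m) => xi q.1 k i j m
  end.

(* The matrix at lag k is A_(k-1), as 'I_p starts at 0. *)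
Definition is_INAR {d p : nat} (a0 : 'cV[R]_d) (A : 'I_p -> 'M[R]_d)
    (X : int -> 'I_d -> {RV P >-> nat}) : Prop :=
  stationary P (fun n i => X n i : T -> nat) /\
  exists (eps : int -> 'I_d -> {RV P >-> nat})
         (xi : int -> 'I_p -> 'I_d -> 'I_d -> nat -> {RV P >-> nat}),
  [/\ forall n i, poisson_law (eps n i) (a0 i 0),
      forall n k i j m, poisson_law (xi n k i j m) (A k i j),
      mutually_independent P (noise eps xi),
      forall n : int, independent_sigma P
        (generated_sigma [set q | q.1 = n] (noise eps xi))
        (generated_sigma [set q : int * 'I_d | q.1 < n]
           (fun q => X q.1 q.2 : T -> nat)) &
      forall n : int, {ae P, forall w, forall i, X n i w =
        (\sum_(k < p) mreproduction (xi n k)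
           (fun j => X (n - k.+1%:Z)%R j : T -> nat) i w + eps n i w)%N}].

Definition state {d : nat} (X : int -> 'I_d -> {RV P >-> nat}) (n : int)
    (w : T) : 'cV[R]_d := \col_i (X n i w)%:R.

Definition residual {d p : nat} (a0 : 'cV[R]_d) (A : 'I_p -> 'M[R]_d)
    (X : int -> 'I_d -> {RV P >-> nat}) (n : int) (w : T) : 'cV[R]_d :=
  state X n w - a0 - \sum_(k < p) A k *m state X (n - k.+1%:Z) w.

End inar.

(* Main.v *)
(* Conditionally on the past, X_n is a sum of independent Poisson variables with
   total rate a_0 + sum_k A_k X_(n-k), so u_n has conditional mean 0 and
   conditional covariance diag(a_0 + sum_k A_k X_(n-k)). Conditioning is done by
   freezing: the past enters only through finitely many of the X_m, which form a
   countably-valued variable, so one integrates over each of its fibers, where the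
   noise is independent of the past. Everything then follows once E X_n < oo,
   which is not part of the definition of an INAR sequence.

   Write K for the sum of the A_k. As det(1 - t K) has no zero for t in [0, 1],
   there is h >= 0 with h^T K = h^T - 1^T. Put b_k = h^T sum_(l > k) A_l and
   V_n = h^T X_n + sum_(0 < k < p) b_k X_(n-k). Then
   E[V_n | past] = c + V_(n-1) - |X_(n-1)| with c = h^T a_0. Since min(., M) is
   concave and E min(V_n, M) does not depend on n, this gives
   E[|X_n|; V_n <= M] <= c for all M, hence E |X_n| <= c. *)

Require Import Defs.
From HB Require Import structures.
From mathcomp Require Import all_boot all_order all_algebra.
From mathcomp Require Import complex ring lra zify.
From mathcomp Require Import all_classical all_reals all_analysis.
From mathcomp Require Import measurable_realfun.

Set Implicit Arguments.
Unset Strict Implicit.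
Unset Printing Implicit Defensive.

Import Order.TTheory GRing.Theory Num.Theory.
Import numFieldNormedType.Exports.

Local Open Scope classical_set_scope.
Local Open Scope ring_scope.

(** * Independence and integration over fibers *)

Lemma funepos_comp {T U : Type} {R : realDomainType} (phi : U -> \bar R) (f : T -> U) :
  ((phi \o f)^\+ = phi^\+ \o f)%E.
Proof. by apply/funext => x; rewrite /= !funeposE. Qed.

Lemma funeneg_comp {T U : Type} {R : realDomainType} (phi : U -> \bar R) (f : T -> U) :
  ((phi \o f)^\- = phi^\- \o f)%E.
Proof. by apply/funext => x; rewrite /= !funenegE. Qed.

Section independence.
Context {disp : measure_display} {T : measurableType disp} {R : realType}.
Variable P : probability T R.
Local Open Scope ereal_scope.

(** The restricted measure gives the complement of [B] mass 0 and agrees with [P] on subsets of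
    [B]. *)
Lemma integral_mrestr (B : set T) (mB : measurable B) (g : T -> \bar R) :
  measurable_fun [set: T] g -> (forall x, 0 <= g x) ->
  \int[mrestr P mB]_x g x = \int[P]_(x in B) g x.
Proof.
move=> mg g0; rewrite -(setUv B) ge0_integral_setU//=.
- rewrite [X in _ + X]null_set_integral ?adde0//.
  + apply: eq_measure_integral => A mA AB.
    by rewrite -[in RHS](setIidl AB).
  + exact: measurableC.
  + exact: measurable_funTS.
  + have : P (~` B `&` B) = 0 by rewrite setICl measure0.
    exact.
- exact: measurableC.
- by rewrite setUv.
- by rewrite disj_set2E setICr.
Qed.

(** By independence, the image under [f] of [P] restricted to [B] is the law of [f] scaled by the
    constant [P B]. *)
Lemma ge0_integral_indep (B : set T) (f : T -> R) (phi : R -> \bar R) :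
  measurable B -> measurable_fun [set: T] f ->
  (forall C, measurable C -> P (B `&` f @^-1` C) = P B * P (f @^-1` C)) ->
  measurable_fun [set: R] phi -> (forall x, 0 <= phi x) ->
  \int[P]_(x in B) phi (f x) = P B * \int[P]_x phi (f x).
Proof.
move=> mB mf ind mphi phi0.
have mpf : measurable_fun [set: T] (phi \o f) by exact: measurableT_comp.
have PB0 : (0 <= fine (P B))%R by exact: fine_ge0.
rewrite -(@integral_mrestr B mB (phi \o f)) => [|//|x]; last exact: phi0.
rewrite -[LHS](@ge0_integral_pushforward _ _ _ _ _ _ mf (mrestr P mB) setT)//.
rewrite -[in RHS](preimage_setT f).
rewrite -[X in _ = _ * X](@ge0_integral_pushforward _ _ _ _ _ _ mf P setT)//.
rewrite (eq_measure_integral (mscale (NngNum PB0) (pushforward P f))).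
  by rewrite ge0_integral_mscale//= fineK// fin_num_measure.
move=> A mA _; transitivity (P (f @^-1` A `&` B)) => //; rewrite setIC ind//.
by rewrite -[in LHS](fineK (fin_num_measure P B mB)).
Qed.

(** The positive and negative parts factor separately; both have finite integrals, so [P B] can be
    taken out of their difference. *)
Lemma integral_indep_eq0 (B : set T) (f : T -> R) :
  measurable B -> P.-integrable setT (EFin \o f) ->
  (forall C, measurable C -> P (B `&` f @^-1` C) = P B * P (f @^-1` C)) ->
  \int[P]_x (f x)%:E = 0 -> \int[P]_(x in B) (f x)%:E = 0.
Proof.
move=> mB fint ind f0.
have mf : measurable_fun [set: T] f by apply/measurable_EFinP; exact: measurable_int fint.
have mE : measurable_fun [set: R] (@EFin R) by exact: EFin_measurable.
rewrite integralE.
have -> : \int[P]_(x in B) (EFin \o f)^\+ x = P B * \int[P]_x (EFin \o f)^\+ x.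
  rewrite funepos_comp.
  apply: (ge0_integral_indep mB mf ind (measurable_funepos mE)) => x.
  exact: funepos_ge0.
have -> : \int[P]_(x in B) (EFin \o f)^\- x = P B * \int[P]_x (EFin \o f)^\- x.
  rewrite funeneg_comp.
  apply: (ge0_integral_indep mB mf ind (measurable_funeneg mE)) => x.
  exact: funeneg_ge0.
rewrite -muleBr ?fin_num_measure//; last first.
  by rewrite fin_num_adde_defr// (integrable_pos_fin_num _ fint).
by rewrite -integralE f0 mule0.
Qed.

End independence.

Section fibers.
Context {disp : measure_display} {T : measurableType disp} {R : realType}.
Variables (P : {measure set T -> \bar R}) (S : countType) (Z : T -> S).
Hypothesis mZ : forall s, measurable (Z @^-1` [set s]).
Local Open Scope ereal_scope.

(** Fibers are numbered by codes in [nat], so that countable additivity applies; a number that codes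
    no point gives the empty set. *)
Let F k := [set w | pickle (Z w) = k].

Let F_fiber k : F k = set0 \/ exists s, F k = Z @^-1` [set s].
Proof.
case Ek : (@pickle_inv S k) => [s|].
  right; exists s; rewrite /F; apply/seteqP; split => w /= => [wk|->].
    by move: Ek; rewrite -wk pickleK_inv => -[].
  by have := @pickle_invK S k; rewrite Ek.
left; apply/seteqP; split => w //= wk.
by move: Ek; rewrite -wk pickleK_inv.
Qed.

Let mF k : measurable (F k).
Proof. by have [->|[s ->]] := F_fiber k. Qed.

Let tF : trivIset setT F.
Proof. by move=> i j _ _ [w [/= <- <-]]. Qed.

Let UF : \bigcup_k F k = setT.
Proof. by apply/seteqP; split => // w _; exists (pickle (Z w)). Qed.

(** Any map [a] will do, as a preimage under [a \o Z] is a countable union of measurable fibers of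
    [Z]. *)
Lemma measurable_fun_fibers {d'} {E : measurableType d'} (a : S -> E) :
  measurable_fun [set: T] (a \o Z).
Proof.
move=> _ Y mY; rewrite setTI.
rewrite (_ : _ @^-1` Y = \bigcup_k (F k `&` (a \o Z) @^-1` Y)).
  apply: bigcupT_measurable => k; have [->|[s ->]] := F_fiber k.
    by rewrite set0I.
  have [Yas|nYas] := pselect (Y (a s)).
    by rewrite setIidl// => w /= ->.
  by rewrite (_ : _ `&` _ = set0)//; apply/seteqP; split => // w [/= ->].
by rewrite -setI_bigcupl UF setTI.
Qed.

Lemma ge0_le_integral_fibers (f g : T -> \bar R) :
  measurable_fun [set: T] f -> measurable_fun [set: T] g ->
  (forall w, 0 <= f w) -> (forall w, 0 <= g w) ->
  (forall s, \int[P]_(w in Z @^-1` [set s]) f w <=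
             \int[P]_(w in Z @^-1` [set s]) g w) ->
  \int[P]_w f w <= \int[P]_w g w.
Proof.
move=> mf mg f0 g0 fg; rewrite -UF !ge0_integral_bigcup//; rewrite ?UF//.
apply: lee_nneseries => [k _ _|k _].
  exact: integral_ge0.
by have [->|[s ->]] := F_fiber k; rewrite ?integral_set0.
Qed.

Lemma integral_fibers_eq0 (f : T -> \bar R) :
  P.-integrable setT f ->
  (forall s, \int[P]_(w in Z @^-1` [set s]) f w = 0) ->
  \int[P]_w f w = 0.
Proof.
move=> fint f0; rewrite -UF integral_bigcup// ?UF//.
by apply: eseries0 => k _ _; have [->|[s ->]] := F_fiber k; rewrite ?integral_set0.
Qed.

End fibers.

(** * Superharmonic vectors of nonnegative matrices *)

Section subinvariant.
Context {R : realType} {d : nat}.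
Implicit Type K : 'M[R]_d.

(* With [q t = \det (1 - t K)] and [y t = \adj (1 - t K) 1], one has
   [y t = q t + t K (y t)], so that as soon as [y t >= 0] one even has
   [y t >= q t > 0]: the least entry of [2 y - q] never vanishes on [0, 1]. *)
Lemma exists_superharmonic K :
  (forall i j, 0 <= K i j) ->
  (forall t, 0 <= t <= 1 -> \det (1%:M - t *: K) != 0) ->
  exists h : 'cV[R]_d, (forall i, 0 <= h i 0) /\ K *m h = h - const_mx 1.
Proof.
move=> K0 detK.
pose Kp : 'M[{poly R}]_d := 1%:M - 'X *: map_mx polyC K.
have evK t : map_mx (horner_eval t) Kp = 1%:M - t *: K.
  apply/matrixP => i j; rewrite !mxE /horner_eval hornerD hornerN hornerM.
  by rewrite hornerX hornerC -polyC_natr hornerC.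
pose q := \det Kp.
have qE t : q.[t] = \det (1%:M - t *: K) by rewrite -evK det_map_mx.
pose y i := \sum_j (\adj Kp) i j.
have yE t : (1%:M - t *: K) *m (\col_i (y i).[t]) = const_mx q.[t].
  have : Kp *m \adj Kp *m const_mx 1 = const_mx q :> 'cV_d.
    by rewrite mul_mx_adj mul_scalar_mx; apply/matrixP => i j; rewrite !mxE mulr1.
  move=> /(congr1 (map_mx (horner_eval t))); rewrite -mulmxA map_mxM evK map_const_mx => <-.
  congr (_ *m _); apply/matrixP => i j; rewrite !mxE.
  rewrite /horner_eval /y; congr (_.[_]); apply: eq_bigr => k _.
  by rewrite [const_mx _ _ _]mxE mulr1.
have yE' t i : (y i).[t] = q.[t] + t * \sum_j K i j * (y j).[t].
  have /matrixP/(_ i 0) := yE t.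
  rewrite mulmxBl mul1mx -scalemxAl !mxE => /eqP.
  rewrite subr_eq => /eqP ->; congr (_ + _ * _).
  by apply: eq_bigr => j _; rewrite !mxE.
have q0 : q.[0] = 1 by rewrite qE scale0r subr0 det1.
have q_gt0 t : 0 <= t <= 1 -> 0 < q.[t].
  (* Since q(0) = 1, a nonpositive value at t would produce a root in [0, t]. *)
  move=> /andP[t0 t1]; rewrite ltNge; apply/negP => qt.
  have [|x xt /rootP] := @polyrcf.poly_ivt R q 0 t t0.
    by rewrite q0 mul1r.
  rewrite in_itv/= in xt; case/andP: xt => x0 xt.
  by rewrite qE; apply/eqP/detK; rewrite x0 (le_trans xt).
(* The neutral value 1 is positive and equals 2 y - q at t = 0, so it affects neither the sign of
   [m] nor its initial value. *)
pose m t : R := \big[Num.min/1]_i (2 * (y i).[t] - q.[t]).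
have cm : continuous m.
  rewrite /m => x.
  elim: (index_enum _) => [|i s IH].
    by under eq_fun do rewrite big_nil; exact: cst_continuous.
  under eq_fun do rewrite big_cons.
  have cf : {for x, continuous (fun t => 2 * (y i).[t] - q.[t] : R^o)}.
    rewrite (_ : (fun _ => _) = horner (2%:P * y i - q)).
      exact: continuous_horner.
    by apply/funext => z; rewrite hornerD hornerN hornerM hornerC.
  exact: (continuous_min cf IH).
have m_neq0 t : 0 <= t <= 1 -> m t != 0.
  move=> t01; apply/eqP => mt0; have qt := q_gt0 t t01.
  have y_ge0 i : 0 <= (y i).[t].
    have /bigmin_geP[_ /(_ i isT)] : 0 <= m t by rewrite mt0.
    by move: qt; clear; lra.
  have : 0 < m t; last by rewrite mt0 ltxx.
  apply/bigmin_gtP; split=> // i _.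
  have : q.[t] <= (y i).[t]; last by move: qt; clear; lra.
  rewrite [leRHS]yE' lerDl mulr_ge0//; first by case/andP: t01.
  by apply: sumr_ge0 => j _; rewrite mulr_ge0.
have m0 : m 0 = 1.
  rewrite /m; apply: bigmin_eq_id => i _.
  by rewrite yE' q0 mul0r addr0 mulr1; lra.
have m1 : 0 < m 1.
  rewrite ltNge; apply/negP => m1.
  have [||c c01 mc] := @IVT R m 0 1 0 ler01.
  - by apply: continuous_subspaceT.
  - by rewrite m0 ge_min le_max m1 ler01 orbT.
  by have := m_neq0 c; rewrite mc eqxx => /(_ c01).
have q1 : 0 < q.[1] by apply: q_gt0; rewrite ler01 lexx.
(* At t = 1 the identity reads y = q + K y; division by q(1) > 0 normalizes the constant to 1. *)
exists (\col_i ((y i).[1] / q.[1])); split=> [i|].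
  rewrite mxE divr_ge0 ?(ltW q1)//.
  have /bigmin_gtP[_ /(_ i isT)] := m1.
  by move: q1; clear; lra.
apply/matrixP => i j; rewrite ord1 !mxE [in RHS]yE' mul1r mulrDl divff ?gt_eqF//.
rewrite addrAC subrr add0r mulr_suml; apply: eq_bigr => k _.
by rewrite !mxE mulrA.
Qed.

(** A zero t in (0, 1] would make 1/t >= 1 a zero of the characteristic polynomial, outside the open
    unit disk. *)
Lemma det_sub_scale_neq0 K :
  (forall z : complex R,
    \det (z%:M - map_mx (real_complex R) K) = 0 -> `|z| < 1) ->
  forall t, 0 <= t <= 1 -> \det (1%:M - t *: K) != 0.
Proof.
move=> zK t /andP[t0 t1]; have [->|tn0] := eqVneq t 0.
  by rewrite scale0r subr0 det1 oner_eq0.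
apply/eqP => dt0; have /zK : \det ((real_complex R t^-1)%:M - map_mx (real_complex R) K) = 0.
  rewrite -map_scalar_mx -map_mxB det_map_mx.
  have -> : t^-1%:M - K = t^-1 *: (1%:M - t *: K).
    by rewrite scalerBr scalerA mulVf// scale1r scalemx1.
  by rewrite detZ dt0 mulr0 rmorph0.
rewrite normc_def/= expr0n/= addr0 sqrtr_sqr ltcR ltNge ger0_norm ?invr_ge0//.
by rewrite -[leLHS]invr1 lef_pV2 ?posrE// ?t1// lt_def tn0 t0.
Qed.

End subinvariant.

(** * Means of real random variables and Poisson moments *)

Section mean.
Context {disp : measure_display} {T : measurableType disp} {R : realType}.
Variable P : probability T R.
Implicit Types f g : T -> R.

(** Integrability is bundled with the value, so that linearity never meets infinities of opposite
    sign. *)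
Definition has_mean f (m : R) : Prop :=
  P.-integrable [set: T] (EFin \o f) /\ (\int[P]_w (f w)%:E = m%:E)%E.

Lemma has_mean_measurable f m : has_mean f m -> measurable_fun [set: T] f.
Proof. by move=> [/measurable_int mf _]; exact/measurable_EFinP. Qed.

Lemma ge0_has_mean f m : measurable_fun [set: T] f -> (forall w, 0 <= f w) ->
  (\int[P]_w (f w)%:E = m%:E)%E -> has_mean f m.
Proof.
move=> mf f0 fm; split => //; apply/integrableP; split.
  exact/measurable_EFinP.
under eq_integral => w _ do rewrite /= ger0_norm//.
by rewrite fm ltry.
Qed.

Lemma has_mean_cst k : has_mean (fun=> k) k.
Proof.
split; first exact: finite_measure_integrable_cst.
by rewrite integral_cst//= probability_setT mule1.
Qed.

Lemma has_meanD f g a b : has_mean f a -> has_mean g b ->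
  has_mean (fun w => f w + g w) (a + b).
Proof.
move=> [fi fa] [gi gb]; split.
  exact: (integrableD measurableT fi gi).
by under eq_integral do rewrite EFinD; rewrite integralD// fa gb.
Qed.

Lemma has_meanZ k f a : has_mean f a -> has_mean (fun w => k * f w) (k * a).
Proof.
move=> [fi fa]; split; first exact: (integrableZl measurableT k fi).
by under eq_integral do rewrite EFinM; rewrite integralZl// fa.
Qed.

Lemma has_meanB f g a b : has_mean f a -> has_mean g b ->
  has_mean (fun w => f w - g w) (a - b).
Proof.
move=> fa /(has_meanZ (-1)) gb.
under eq_fun do rewrite -mulN1r; rewrite -[- b]mulN1r.
exact: has_meanD.
Qed.

Lemma has_mean_sum (I : Type) (s : seq I) (F : I -> T -> R) (a : I -> R) :
  (forall i, has_mean (F i) (a i)) ->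
  has_mean (fun w => \sum_(i <- s) F i w) (\sum_(i <- s) a i).
Proof.
move=> Fa; elim: s => [|i s IH].
  by under eq_fun do rewrite big_nil; rewrite big_nil; exact: has_mean_cst.
by under eq_fun do rewrite big_cons; rewrite big_cons; exact: has_meanD.
Qed.

Lemma has_mean_le f g a b : (forall w, f w <= g w) ->
  has_mean f a -> has_mean g b -> a <= b.
Proof.
move=> fg [fi fa] [gi gb]; rewrite -lee_fin -fa -gb.
by apply: le_integral => // w _; rewrite lee_fin.
Qed.

Lemma has_mean_inj f a b : has_mean f a -> has_mean f b -> a = b.
Proof. by move=> [_ fa] [_]; rewrite fa => -[]. Qed.

(** The product is dominated by [f ^+ 2 + g ^+ 2], because (|f| - |g|)^2 >= 0. *)
Lemma integrable_mul_sqr f g : measurable_fun [set: T] f ->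
  measurable_fun [set: T] g ->
  P.-integrable [set: T] (EFin \o (fun w => f w ^+ 2)) ->
  P.-integrable [set: T] (EFin \o (fun w => g w ^+ 2)) ->
  P.-integrable [set: T] (EFin \o (fun w => f w * g w)).
Proof.
move=> mf mg f2 g2; apply: le_integrable (integrableD measurableT f2 g2) => //.
  by apply/measurable_EFinP; exact: measurable_funM.
move=> w _; rewrite /= !lee_fin normrM [leRHS]ger0_norm ?addr_ge0 ?sqr_ge0//.
rewrite -(real_normK (num_real (f w))) -(real_normK (num_real (g w))).
have := sqr_ge0 (`|f w| - `|g w|); rewrite sqrrB.
have : 0 <= `|f w| * `|g w| by rewrite mulr_ge0.
by rewrite -mulr_natl; lra.
Qed.

Lemma integrable_sqr f : measurable_fun [set: T] f ->
  P.-integrable [set: T] (EFin \o (fun w => f w ^+ 2)) ->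
  P.-integrable [set: T] (EFin \o f).
Proof.
move=> mf f2; have -> : f = fun w => f w * cst 1 w.
  by apply/funext => w; rewrite mulr1.
apply: integrable_mul_sqr => //; under eq_fun do rewrite expr1n.
exact: finite_measure_integrable_cst.
Qed.

End mean.

Section nat_measure.
Context {R : realType}.
Local Open Scope ereal_scope.

Lemma ge0_integral_nat (m : {measure set nat -> \bar R}) (f : nat -> \bar R) :
  (forall k, 0 <= f k) ->
  \int[m]_k f k = \sum_(k <oo) f k * m [set k].
Proof.
move=> f0; have -> : [set: nat] = \bigcup_k [set k].
  by apply/seteqP; split => // k _; exists k.
rewrite ge0_integral_bigcup//; last by move=> i j _ _ [k [/= -> ->]].
apply: eq_eseriesr => k _.
rewrite (eq_integral (cst (f k))) => [|i]; last by rewrite inE/= => ->.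
by rewrite integral_cst.
Qed.

Lemma ge0_integral_poisson (rate : R) (f : nat -> \bar R) : (0 < rate)%R ->
  (forall k, 0 <= f k) ->
  \int[poisson_prob rate 0%N]_k f k = \sum_(k <oo) f k * (poisson_pmf rate k)%:E.
Proof.
move=> r0 f0; rewrite ge0_integral_nat//; apply: eq_eseriesr => k _.
congr (_ * _); transitivity (poisson_prob rate 0%N [set k]) => //.
by rewrite /poisson_prob r0 esum_set1// lee_fin poisson_pmf_ge0.
Qed.

(** The Chen-Stein identity: k pmf(k) = rate pmf(k - 1), followed by a shift of the series. Taking g
    = 1 and g(k) = k yields the first two moments. *)
Lemma poisson_chen_stein (rate : R) (g : nat -> \bar R) : (0 <= rate)%R ->
  (forall k, 0 <= g k) ->
  \int[poisson_prob rate 0%N]_k (k%:R%:E * g k) =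
  rate%:E * \int[poisson_prob rate 0%N]_k g k.+1.
Proof.
move=> r0 g0; have kg0 k : 0 <= k%:R%:E * g k by rewrite mule_ge0// lee_fin.
(* For rate 0 the law is the Dirac mass at 0: the factor k kills the term k = 0, and the mass kills
   all others. *)
rewrite le_eqVlt in r0; case/predU1P: r0 => [<-|r0].
  rewrite ge0_integral_nat// mul0e eseries0// => k _ _.
  case: k => [|k]; first by rewrite !mul0e.
  rewrite -[RHS](mule0 (k.+1%:R%:E * g k.+1)); congr (_ * _).
  transitivity (poisson_prob (0 : R) 0%N [set k.+1]) => //.
  by rewrite /poisson_prob ltxx diracE memNset.
have pg0 k : 0 <= k%:R%:E * g k * (poisson_pmf rate k)%:E.
  by rewrite mule_ge0// lee_fin poisson_pmf_ge0.
rewrite !ge0_integral_poisson// nneseries_recl; last 2 first.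
- by [].
- by [].
rewrite !mul0e add0e -nneseriesZl; last first.
  by move=> k _; rewrite mule_ge0// lee_fin poisson_pmf_ge0.
rewrite -[LHS]nneseries_addn//.
under eq_eseriesr do rewrite addn1.
apply: eq_eseriesr => k _.
rewrite [_ * g _]muleC -muleA [RHS]muleCA; congr (_ * _); rewrite -!EFinM; congr EFin.
rewrite /poisson_pmf r0 factS natrM exprS invfM.
have : (k`!%:R != 0 :> R)%R by rewrite pnatr_eq0 -lt0n fact_gt0.
have : (k.+1%:R != 0 :> R)%R by rewrite pnatr_eq0.
by move=> ? ?; field; apply/andP; split.
Qed.

End nat_measure.

Section noise_moments.
Context {disp : measure_display} {T : measurableType disp} {R : realType}.
Variable P : probability T R.

Lemma ge0_integral_poisson_law (Y : {RV P >-> nat}) (rate : R)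
    (g : nat -> \bar R) :
  poisson_law Y rate -> (forall k, 0 <= g k)%E ->
  (\int[P]_w g (Y w) = \int[poisson_prob rate 0%N]_k g k)%E.
Proof.
move=> Yr g0.
rewrite -[LHS](@ge0_integral_distribution _ _ _ _ _ P Y g)//.
by apply: eq_measure_integral => A mA _; exact: Yr.
Qed.

Lemma poisson_law_mean (Y : {RV P >-> nat}) (rate : R) : 0 <= rate ->
  poisson_law Y rate -> has_mean P (fun w => (Y w)%:R) rate.
Proof.
move=> r0 Yr; apply: ge0_has_mean => //.
  exact: measurableT_comp.
rewrite (ge0_integral_poisson_law (g := fun k => k%:R%:E) Yr)//.
under eq_integral => k _ do rewrite -[k%:R%:E]mule1.
rewrite poisson_chen_stein// integral_cst// mul1e -[RHS]mule1.
by congr (_ * _)%E; exact: (@probability_setT _ _ _ (poisson_prob rate 0%N)).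
Qed.

Lemma poisson_law_second_moment (Y : {RV P >-> nat}) (rate : R) : 0 <= rate ->
  poisson_law Y rate ->
  has_mean P (fun w => (Y w)%:R ^+ 2) (rate * (rate + 1)).
Proof.
move=> r0 Yr; apply: ge0_has_mean => //.
  by apply: measurable_funX; exact: measurableT_comp.
rewrite (ge0_integral_poisson_law (g := fun k => (k%:R ^+ 2)%:E) Yr); last first.
  by move=> k; rewrite lee_fin sqr_ge0.
under eq_integral => k _ do rewrite expr2 EFinM.
rewrite (poisson_chen_stein (g := fun k => k%:R%:E))//.
rewrite -(ge0_integral_poisson_law (g := fun k => k.+1%:R%:E) Yr)//.
have [_] := has_meanD (poisson_law_mean r0 Yr) (has_mean_cst P 1).
by under eq_integral do rewrite natr1; rewrite EFinM => ->.
Qed.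

Lemma poisson_law_centered_sqr (Y : {RV P >-> nat}) (rate : R) : 0 <= rate ->
  poisson_law Y rate -> has_mean P (fun w => ((Y w)%:R - rate) ^+ 2) rate.
Proof.
move=> r0 Yr.
have -> : (fun w => ((Y w)%:R - rate) ^+ 2) =
    (fun w => (Y w)%:R ^+ 2 - 2 * rate * (Y w)%:R + rate ^+ 2).
  by apply/funext => w; ring.
rewrite [X in has_mean P _ X](_ : rate =
  rate * (rate + 1) - 2 * rate * rate + rate ^+ 2); last by ring.
apply: has_meanD; last exact: has_mean_cst.
apply: has_meanB; first exact: poisson_law_second_moment.
by apply: has_meanZ; exact: poisson_law_mean.
Qed.

(** On each fiber of [Y1] the first factor is a constant, and the centered second factor integrates
    to 0 by independence. *)
Lemma has_mean_mul_indep (Y1 Y2 : T -> nat) (f1 f2 : nat -> R) :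
  measurable_fun [set: T] Y1 -> measurable_fun [set: T] Y2 ->
  independent_sigma P (preimage_set_system setT Y1 measurable)
                      (preimage_set_system setT Y2 measurable) ->
  P.-integrable [set: T] (EFin \o (fun w => f1 (Y1 w) ^+ 2)) ->
  P.-integrable [set: T] (EFin \o (fun w => f2 (Y2 w) ^+ 2)) ->
  has_mean P (fun w => f2 (Y2 w)) 0 ->
  has_mean P (fun w => f1 (Y1 w) * f2 (Y2 w)) 0.
Proof.
move=> mY1 mY2 ind i1 i2 m2.
have mf1 : measurable_fun [set: T] (f1 \o Y1) by exact: measurableT_comp.
have mf2 : measurable_fun [set: T] (f2 \o Y2) by exact: measurableT_comp.
have i12 := integrable_mul_sqr mf1 mf2 i1 i2.
split => //; apply: (@integral_fibers_eq0 _ _ _ P nat Y1) => // [k|k].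
  by rewrite -[X in measurable X]setTI; exact: mY1.
have mk : measurable (Y1 @^-1` [set k]).
  by rewrite -[X in measurable X]setTI; exact: mY1.
transitivity (\int[P]_(w in Y1 @^-1` [set k]) (f1 k * f2 (Y2 w))%:E)%E.
  by apply: eq_integral => w; rewrite inE /= => ->.
have [zi z0] := has_meanZ (f1 k) m2; rewrite mulr0 in z0.
apply: integral_indep_eq0 => // C mC; apply: ind.
  by exists [set k] => //; rewrite setTI.
by exists ((fun k' => f1 k * f2 k') @^-1` C) => //; rewrite setTI.
Qed.

End noise_moments.

(** * Freezing the past *)

Section freezing.
Context {disp : measure_display} {T : measurableType disp} {R : realType}.
Variables (P : probability T R) (F H : set_system T).
Hypotheses (F_measurable : F `<=` measurable) (H_measurable : H `<=` measurable).
Hypothesis indFH : independent_sigma P F H.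
Variables (S : countType) (Z : T -> S).
Hypothesis ZH : forall s, H (Z @^-1` [set s]).

Definition adapted {d'} {E : measurableType d'} (G : set_system T) (f : T -> E) :=
  forall C, measurable C -> G (f @^-1` C).

Let mZ s : measurable (Z @^-1` [set s]).
Proof. by apply: H_measurable; exact: ZH. Qed.

Variables (g : T -> R) (f : S -> T -> R) (a : S -> R).
Hypothesis fF : forall s, adapted F (f s).
Hypothesis fa : forall s, has_mean P (f s) (a s).
Hypothesis gf : {ae P, forall w, g w = f (Z w) w}.

Let mf s : measurable_fun [set: T] (f s).
Proof. by move=> _ C mC; rewrite setTI; apply: F_measurable; exact: fF. Qed.

Let ind s C : measurable C ->
  (P (Z @^-1` [set s] `&` f s @^-1` C) =
   P (Z @^-1` [set s]) * P (f s @^-1` C))%E.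
Proof. by move=> mC; rewrite setIC indFH 1?muleC//; exact: fF. Qed.

Let integral_fiber s : measurable_fun [set: T] g ->
  (\int[P]_(w in Z @^-1` [set s]) (g w)%:E =
   \int[P]_(w in Z @^-1` [set s]) (f s w)%:E)%E.
Proof.
move=> mg; apply: ae_eq_integral => //.
- by apply: measurable_funTS; exact/measurable_EFinP.
- by apply: measurable_funTS; exact/measurable_EFinP.
- by apply: filterS gf => w -> /= <-.
Qed.

(** On the fiber where [Z] is s, [g] coincides almost everywhere with [f s], which is independent of
    that fiber and centered. *)
Lemma has_mean_freeze0 : (forall s, a s = 0) ->
  P.-integrable [set: T] (EFin \o g) -> has_mean P g 0.
Proof.
move=> a0 gi; split => //.
apply: (integral_fibers_eq0 (Z := Z)) => // s.
rewrite integral_fiber; last exact/measurable_EFinP/(measurable_int _ gi).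
have [fi f0] := fa s; apply: (integral_indep_eq0 _ fi (@ind s)) => //.
by rewrite f0 a0.
Qed.

(** The tower property, with [a (Z w)] as the conditional mean of [g]. Nonnegativity stands in for
    integrability, so both sides may be infinite. *)
Lemma ge0_integral_freeze : measurable_fun [set: T] g ->
  (forall w, 0 <= g w) -> (forall s w, 0 <= f s w) -> (forall s, 0 <= a s) ->
  (\int[P]_w (g w)%:E = \int[P]_w (a (Z w))%:E)%E.
Proof.
move=> mg g0 f0 a0.
have eqs s : (\int[P]_(w in Z @^-1` [set s]) (g w)%:E =
    \int[P]_(w in Z @^-1` [set s]) (a (Z w))%:E)%E.
  rewrite integral_fiber//.
  transitivity (P (Z @^-1` [set s]) * (a s)%:E)%E.
    have [_ <-] := fa s.
    (* The integrand must be nonnegative on the whole line, hence the positive part, which is the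
       identity on the values of [f s]. *)
    have := @ge0_integral_indep _ _ _ P _ (f s) (fun x => (Num.max x 0)%:E)
      (mZ s) (mf s) (@ind s).
    under eq_integral do rewrite max_l//.
    under [X in (_ * X)%E]eq_integral do rewrite max_l//.
    apply => [|x]; last by rewrite lee_fin le_max lexx orbT.
    by apply/measurable_EFinP; exact: measurable_maxr.
  rewrite (eq_integral (cst (a s)%:E)) => [|w]; last by rewrite inE /= => ->.
  by rewrite integral_cst// muleC.
have mEg : measurable_fun [set: T] (EFin \o g) by exact/measurable_EFinP.
have mEa : measurable_fun [set: T] (EFin \o (a \o Z)).
  by apply/measurable_EFinP; exact: measurable_fun_fibers.
by apply/eqP; rewrite eq_le; apply/andP; split;
  apply: (ge0_le_integral_fibers (Z := Z)) => // *; rewrite ?lee_fin ?eqs.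
Qed.

End freezing.

(** * Second moments of sums of independent centered variables *)

Section orthogonal_sums.
Context {disp : measure_display} {T : measurableType disp} {R : realType}.
Variables (P : probability T R) (I : eqType) (N : I -> T -> nat) (r : I -> R).
Hypothesis mN : forall q, measurable_fun [set: T] (N q).
Hypothesis indN : mutually_independent P N.
Hypothesis N_mean : forall q, has_mean P (fun w => (N q w)%:R) (r q).
Hypothesis N_sqr : forall q, has_mean P (fun w => ((N q w)%:R - r q) ^+ 2) (r q).

Lemma centered_mean q : has_mean P (fun w => (N q w)%:R - r q) 0.
Proof. by rewrite -(subrr (r q)); apply: has_meanB => //; exact: has_mean_cst. Qed.

(** On the diagonal the variance is the rate, as for Poisson variables; off it, mutual independence
    is applied to the list [[:: q; q']]. *)
Lemma centered_covariance q q' :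
  has_mean P (fun w => ((N q w)%:R - r q) * ((N q' w)%:R - r q'))
    (if q == q' then r q else 0).
Proof.
have [<-|qq'] := eqVneq; first exact: N_sqr.
apply: (@has_mean_mul_indep _ _ _ P (N q) (N q') (fun k => k%:R - r q)
  (fun k => k%:R - r q')) => //.
- move=> _ _ [B mB <-] [C mC <-]; rewrite !setTI.
  have := indN (s := [:: q; q']) (B := fun i => if i == q then B else C).
  rewrite /= andbT inE qq' big_cons big_seq1 eqxx eq_sym (negbTE qq').
  rewrite (_ : \bigcap_(_ in _) _ = N q @^-1` B `&` N q' @^-1` C).
    by apply => // i; case: ifP.
  apply/seteqP; split => [w Nw|w [Bw Cw] i].
    split; first by have /= := Nw q; rewrite eqxx; apply; rewrite inE eqxx.
    have /= := Nw q'; rewrite eq_sym (negbTE qq'); apply.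
    by rewrite !inE eqxx orbT.
  by rewrite /= !inE => /orP[]/eqP ->; rewrite ?eqxx// eq_sym (negbTE qq').
- by case: (N_sqr q).
- by case: (N_sqr q').
- exact: centered_mean.
Qed.

Lemma centered_sum_mul (l l' : seq I) :
  has_mean P (fun w => (\sum_(q <- l) ((N q w)%:R - r q)) *
                       (\sum_(q <- l') ((N q w)%:R - r q)))
    (\sum_(q <- l) \sum_(q' <- l') if q == q' then r q else 0).
Proof.
under eq_fun do rewrite mulr_suml; apply: has_mean_sum => q.
by under eq_fun do rewrite mulr_sumr; apply: has_mean_sum => q'; exact: centered_covariance.
Qed.

(** The double sum of covariances keeps its diagonal only; without repetitions in [l], each source
    meets itself exactly once. *)
Lemma centered_sum_sqr (l : seq I) : uniq l ->
  has_mean P (fun w => (\sum_(q <- l) ((N q w)%:R - r q)) ^+ 2)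
    (\sum_(q <- l) r q).
Proof.
move=> ul; rewrite [X in has_mean P _ X](_ : _ =
  \sum_(q <- l) \sum_(q' <- l) if q == q' then r q else 0).
  exact: centered_sum_mul.
rewrite !big_seq; apply: eq_bigr => q ql.
rewrite (bigD1_seq q)//= eqxx big1 ?addr0// => q' qq'.
by rewrite eq_sym (negbTE qq').
Qed.

Lemma centered_sum_orthogonal (l l' : seq I) : (forall q, q \in l -> q \notin l') ->
  has_mean P (fun w => (\sum_(q <- l) ((N q w)%:R - r q)) *
                       (\sum_(q <- l') ((N q w)%:R - r q))) 0.
Proof.
move=> ll'; rewrite [X in has_mean P _ X](_ : _ =
  \sum_(q <- l) \sum_(q' <- l') if q == q' then r q else 0).
  exact: centered_sum_mul.
rewrite !big_seq big1// => q ql; rewrite big_seq big1// => q' ql'.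
by case: eqP => // qq'; move: (ll' q ql); rewrite qq' ql'.
Qed.

End orthogonal_sums.

(** * Functionals of stationary paths *)

Section generated_sigma_theory.
Context {d' : measure_display} {E : measurableType d'} {aT : pointedType} {I : Type}.
Variables (D : set I) (Y : I -> aT -> E).

Let Gs := \bigcup_(i in D) preimage_set_system setT (Y i) measurable.

Lemma generated_sigma_coord i : D i ->
  measurable_fun [set: g_sigma_algebraType Gs] (Y i).
Proof.
move=> Di _ B mB; apply: sub_sigma_algebra.
by exists i => //; exists B.
Qed.

(** Reduces membership in a generated sigma-algebra to the usual closure properties of measurable
    functions. *)
Lemma measurable_fun_adapted {d2} {E2 : measurableType d2} (f : aT -> E2) :
  measurable_fun [set: g_sigma_algebraType Gs] f ->
  forall C, measurable C -> generated_sigma D Y (f @^-1` C).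
Proof. by move=> mf C mC; have := mf measurableT C mC; rewrite setTI. Qed.

End generated_sigma_theory.

Lemma generated_sigma_measurable {disp d' : measure_display}
    {T : measurableType disp} {E : measurableType d'} {I : Type}
    (D : set I) (Y : I -> T -> E) :
  (forall i, D i -> measurable_fun [set: T] (Y i)) ->
  generated_sigma D Y `<=` measurable.
Proof.
move=> mY; apply: smallest_sub; first exact: sigma_algebra_measurable.
by move=> _ [i Di [B mB <-]]; exact: mY.
Qed.

Section equal_laws.
Context {disp : measure_display} {T : measurableType disp} {R : realType}.
Variable P : probability T R.

(** Both integrals are pushed forward to the line, where [phi], the positive part, is nonnegative
    even off the ranges of [f] and [g]. *)
Lemma ge0_integral_eq_law (f g : T -> R) : measurable_fun [set: T] f ->
  measurable_fun [set: T] g ->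
  (forall C, measurable C -> P (f @^-1` C) = P (g @^-1` C)) ->
  (forall w, 0 <= f w) -> (forall w, 0 <= g w) ->
  (\int[P]_w (f w)%:E = \int[P]_w (g w)%:E)%E.
Proof.
move=> mf mg fg f0 g0.
pose phi (x : R) : \bar R := (Num.max x 0)%:E.
have mphi : measurable_fun [set: R] phi.
  by apply/measurable_EFinP; exact: measurable_maxr.
have phi0 x : (0 <= phi x)%E by rewrite lee_fin le_max lexx orbT.
transitivity (\int[P]_w (phi \o f) w)%E.
  by apply: eq_integral => w _; rewrite /phi /= max_l.
transitivity (\int[P]_w (phi \o g) w)%E; last first.
  by apply: eq_integral => w _; rewrite /phi /= max_l.
rewrite -[in LHS](preimage_setT f) -[in RHS](preimage_setT g).
rewrite -[LHS](@ge0_integral_pushforward _ _ _ _ _ _ mf P setT)//.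
rewrite -[RHS](@ge0_integral_pushforward _ _ _ _ _ _ mg P setT)//.
by apply: eq_measure_integral => C mC _; exact: fg.
Qed.

Lemma has_mean_bounded (f : T -> R) (M : R) : measurable_fun [set: T] f ->
  (forall w, 0 <= f w <= M) ->
  has_mean P f (fine (\int[P]_w (f w)%:E)).
Proof.
move=> mf f01.
have fi : P.-integrable [set: T] (EFin \o f).
  have Mi : P.-integrable [set: T] (EFin \o cst M).
    exact: finite_measure_integrable_cst.
  apply: le_integrable Mi => //.
    exact/measurable_EFinP.
  move=> w _; have /andP[f0 fM] := f01 w.
  by rewrite /= lee_fin !ger0_norm// (le_trans f0).
by split => //; rewrite fineK//; exact: (integrable_fin_num measurableT fi).
Qed.

End equal_laws.

Section stationary_functionals.
Context {disp : measure_display} {T : measurableType disp} {R : realType}.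
Variables (P : probability T R) (d : nat) (X : int -> 'I_d -> T -> nat).
Hypothesis statX : stationary P X.

(** The generators of the sigma-algebra used in [stationary], packaged to let path functionals be
    treated as measurable maps. *)
Definition path_display : set (set (int * 'I_d -> nat)) :=
  \bigcup_(q in setT) preimage_set_system setT
    (fun f : int * 'I_d -> nat => f q) measurable.

Definition path_space := g_sigma_algebraType path_display.

Lemma measurable_path_coord q : measurable_fun [set: path_space] (fun f => f q).
Proof.
exact: (@generated_sigma_coord _ _ _ _ setT (fun q (f : int * 'I_d -> nat) => f q)).
Qed.

Lemma stationary_law {d'} {E : measurableType d'} (G : path_space -> E) h C :
  measurable_fun [set: path_space] G -> measurable C ->
  P [set w | C (G (fun q => X (q.1 + h) q.2 w))] =
  P [set w | C (G (fun q => X q.1 q.2 w))].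
Proof.
move=> mG mC; apply: (statX h (B := G @^-1` C)).
exact: (measurable_fun_adapted mG).
Qed.

End stationary_functionals.

(** * Sources of noise entering one component *)

Section active_noise.
Context {d p : nat}.

(* The sources of noise that enter component [i] at time [n] when X_(n-k-1) takes
   the value [s k]. *)
Definition active (n : int) (s : nat -> 'I_d -> nat) (i : 'I_d) :
    seq (int * noise_index d p) :=
  (n, inl i) ::
  [seq (n, inr (kj.1, i, kj.2, m)) |
    kj : 'I_p * 'I_d <- enum {: 'I_p * 'I_d}, m : nat <- iota 0 (s kj.1 kj.2)].

Lemma active_time n s i q : q \in active n s i -> q.1 = n.
Proof. by rewrite inE => /predU1P[->//|/allpairsPdep[kj [m [_ _ ->]]]]. Qed.

(** Used to separate the active sources of distinct components. *)
Definition target (q : int * noise_index d p) : 'I_d :=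
  match q.2 with inl i => i | inr (k, i, j, m) => i end.

Lemma active_target n s i q : q \in active n s i -> target q = i.
Proof. by rewrite inE => /predU1P[->//|/allpairsPdep[kj [m [_ _ ->]]]]. Qed.

Lemma active_uniq n s i : uniq (active n s i).
Proof.
rewrite /= allpairs_uniq_dep ?enum_uniq// => [||[[k j] m] [[k' j'] m'] _ _].
- by rewrite andbT; apply/allpairsPdep => -[kj [m [_ _]]].
- by move=> *; exact: iota_uniq.
- by move=> [-> -> ->].
Qed.

Lemma big_active (V : nmodType) n s i (F : int * noise_index d p -> V) :
  \sum_(q <- active n s i) F q = F (n, inl i) +
  \sum_(k < p) \sum_(j < d) \sum_(m < s k j) F (n, inr (k, i, j, m : nat)).
Proof.
rewrite big_cons; congr (_ + _); rewrite big_allpairs_dep/= big_enum/=.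
rewrite pair_bigA/=; apply: eq_bigr => -[k j] _ /=.
by rewrite -{1}(subn0 (s k j)) -/(index_iota 0 (s k j)) big_mkord.
Qed.

End active_noise.

(** * Residuals as sums of centered noise *)

Lemma measurable_fun_sum_seq {disp} {T : measurableType disp} {R : realType}
    {I : eqType} (l : seq I) (F : I -> T -> R) :
  (forall q, q \in l -> measurable_fun [set: T] (F q)) ->
  measurable_fun [set: T] (fun w => \sum_(q <- l) F q w).
Proof.
elim: l => [|q l IH] mF; first by under eq_fun do rewrite big_nil; exact: measurable_cst.
under eq_fun do rewrite big_cons.
apply: measurable_funD; first by apply: mF; rewrite mem_head.
by apply: IH => q' q'l; apply: mF; rewrite inE q'l orbT.
Qed.

Definition noise_rate {R : realType} {d p : nat} (a0 : 'cV[R]_d)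
    (A : 'I_p -> 'M[R]_d) (q : int * noise_index d p) : R :=
  match q.2 with inl i => a0 i 0 | inr (k, i, j, m) => A k i j end.

Section inar_theory.
Context {disp : measure_display} {T : measurableType disp} {R : realType}.
Context {P : probability T R} {d p : nat}.
Variables (a0 : 'cV[R]_d) (A : 'I_p -> 'M[R]_d).
Variable X : int -> 'I_d -> {RV P >-> nat}.
Hypothesis a0_ge0 : forall i, 0 <= a0 i 0.
Hypothesis A_ge0 : forall k i j, 0 <= A k i j.

Variable eps : int -> 'I_d -> {RV P >-> nat}.
Variable xi : int -> 'I_p -> 'I_d -> 'I_d -> nat -> {RV P >-> nat}.
Hypothesis eps_law : forall n i, poisson_law (eps n i) (a0 i 0).
Hypothesis xi_law : forall n k i j m, poisson_law (xi n k i j m) (A k i j).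
Hypothesis noise_indep : mutually_independent P (noise eps xi).

Local Notation N := (noise eps xi).
Local Notation rate := (noise_rate a0 A).
Local Notation present n := (generated_sigma [set q | q.1 = n] N).
Local Notation past n := (generated_sigma [set q : int * 'I_d | q.1 < n]
  (fun q => X q.1 q.2 : T -> nat)).

Hypothesis noise_past : forall n : int, independent_sigma P (present n) (past n).
Hypothesis recursion : forall n : int, {ae P, forall w, forall i, X n i w =
  (\sum_(k < p) mreproduction (xi n k)
     (fun j => X (n - k.+1%:Z)%R j : T -> nat) i w + eps n i w)%N}.

Lemma measurable_noise q : measurable_fun [set: T] (N q).
Proof. by case: q => n [i|[[[k i] j] m]]; exact: measurable_funPT. Qed.

Lemma noise_rate_ge0 q : 0 <= rate q.
Proof. by case: q => n [i|[[[k i] j] m]]; rewrite ?a0_ge0 ?A_ge0. Qed.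

Lemma noise_mean q : has_mean P (fun w => (N q w)%:R) (rate q).
Proof.
case: q => n [i|[[[k i] j] m]].
- exact: (poisson_law_mean (a0_ge0 i) (eps_law n i)).
- exact: (poisson_law_mean (A_ge0 k i j) (xi_law n k i j m)).
Qed.

Lemma noise_centered_sqr q :
  has_mean P (fun w => ((N q w)%:R - rate q) ^+ 2) (rate q).
Proof.
case: q => n [i|[[[k i] j] m]].
- exact: (poisson_law_centered_sqr (a0_ge0 i) (eps_law n i)).
- exact: (poisson_law_centered_sqr (A_ge0 k i j) (xi_law n k i j m)).
Qed.

Lemma present_measurable n : present n `<=` measurable.
Proof. by apply: generated_sigma_measurable => q _; exact: measurable_noise. Qed.

Lemma past_measurable n : past n `<=` measurable.
Proof. by apply: generated_sigma_measurable => q _; exact: measurable_funPT. Qed.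

(** A finite piece of the past with values in a countable type, as freezing requires. Length [p]
    suffices for one residual; a longer window also determines an earlier residual. *)
Definition window (n : int) (L : nat) (w : T) : seq {ffun 'I_d -> nat} :=
  mkseq (fun k => [ffun j => X (n - k.+1%:Z) j w]) L.

(* [lag z k] plays the role of X_(n-k-1) when [z] is a window before time n. *)
Definition lag (z : seq {ffun 'I_d -> nat}) (k : nat) (j : 'I_d) : nat :=
  nth [ffun => 0%N] z k j.

Lemma lag_window n L w k j : (k < L)%N ->
  lag (window n L w) k j = X (n - k.+1%:Z) j w.
Proof. by move=> kL; rewrite /lag nth_mkseq// ffunE. Qed.

(** A fiber is a finite intersection of coordinate events at times before n, or is empty if [z] has
    the wrong length. *)
Lemma window_past n L z : past n (window n L @^-1` [set z]).
Proof.
pose U := g_sigma_algebraType (\bigcup_(q in [set q : int * 'I_d | q.1 < n])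
  preimage_set_system setT (X q.1 q.2 : T -> nat) measurable).
suff : measurable (window n L @^-1` [set z] : set U) by [].
have [sz|sz] := eqVneq (size z) L; last first.
  rewrite (_ : _ @^-1` _ = set0)//; apply/seteqP; split => // w /= wz.
  by move: sz; rewrite -wz size_mkseq eqxx.
rewrite (_ : _ @^-1` _ = \bigcap_(q in [set: 'I_L * 'I_d])
   (X (n - (val q.1).+1%:Z) q.2 : T -> nat) @^-1` [set lag z q.1 q.2]).
  apply: fin_bigcap_measurable => // -[k j] _ /=.
  rewrite -[X in measurable X]setTI.
  apply: (@generated_sigma_coord _ _ _ _ [set q : int * 'I_d | q.1 < n]
    (fun q => X q.1 q.2 : T -> nat) (n - k.+1%:Z, j)) => //=.
  by rewrite gtrBl.
apply/seteqP; split => [w <- [k j] _ /=|w wz /=]; first by rewrite lag_window.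
apply: (@eq_from_nth _ [ffun => 0%N]); rewrite size_mkseq ?sz// => k kL.
apply/ffunP => j; rewrite nth_mkseq// ffunE.
exact: (wz (Ordinal kL, j)).
Qed.

Lemma reproduction_sum n s i w :
  \sum_(q <- active n s i) (N q w)%:R = (eps n i w)%:R +
  \sum_(k < p) \sum_(j < d) \sum_(m < s k j) (xi n k i j m w)%:R :> R.
Proof. by rewrite big_active. Qed.

Lemma sum_active_rate n (s : nat -> 'I_d -> nat) i :
  \sum_(q <- active n s i) rate q =
  a0 i 0 + \sum_(k < p) \sum_(j < d) A k i j * (s k j)%:R.
Proof.
rewrite big_active; congr (_ + _); apply: eq_bigr => k _; apply: eq_bigr => j _.
by rewrite /noise_rate /= sumr_const card_ord mulr_natr.
Qed.

(** The INAR recursion, regrouped by sources of noise; [p <= L] makes all its lags visible in the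
    window. *)
Lemma ae_active n L : (p <= L)%N -> {ae P, forall w, forall i,
  (X n i w)%:R = \sum_(q <- active n (lag (window n L w)) i) (N q w)%:R :> R}.
Proof.
move=> pL; apply: filterS (recursion n) => w Xw i.
rewrite Xw natrD natr_sum reproduction_sum addrC; congr (_ + _).
apply: eq_bigr => k _; rewrite natr_sum; apply: eq_bigr => j _.
by rewrite lag_window ?(leq_trans (ltn_ord k))// natr_sum.
Qed.

(** The conditional mean of [X n i] given the past. *)
Definition predictor n i w : R :=
  a0 i 0 + \sum_(k < p) \sum_(j < d) A k i j * (X (n - k.+1%:Z) j w)%:R.

Lemma residualE n w i : residual a0 A X n w i 0 = (X n i w)%:R - predictor n i w.
Proof.
rewrite /residual /predictor !mxE summxE opprD addrA; congr (_ - _).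
by apply: eq_bigr => k _; rewrite !mxE; apply: eq_bigr => j _; rewrite !mxE.
Qed.

Lemma predictor_window n L i w : (p <= L)%N ->
  predictor n i w = \sum_(q <- active n (lag (window n L w)) i) rate q.
Proof.
move=> pL; rewrite sum_active_rate; congr (_ + _).
apply: eq_bigr => k _; apply: eq_bigr => j _.
by rewrite lag_window// (leq_trans (ltn_ord k)).
Qed.

(** The residual with the past frozen at [s]. *)
Definition innovation n s i w : R := \sum_(q <- active n s i) ((N q w)%:R - rate q).

Lemma ae_residual n L : (p <= L)%N -> {ae P, forall w, forall i,
  residual a0 A X n w i 0 = innovation n (lag (window n L w)) i w}.
Proof.
move=> pL; apply: filterS (ae_active n pL) => w Xw i.
by rewrite residualE (predictor_window _ _ _ pL) Xw /innovation sumrB.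
Qed.

Section present.
Variable n : int.
Let U := g_sigma_algebraType (\bigcup_(q in [set q | q.1 = n])
  preimage_set_system setT (N q) measurable).

Lemma measurable_present_sum s i :
  measurable_fun [set: U] (fun w : U => \sum_(q <- active n s i) (N q w)%:R : R).
Proof.
apply: measurable_fun_sum_seq => q /active_time qn.
apply: (@measurableT_comp _ _ _ _ _ _ (fun k : nat => k%:R : R)) => //.
exact: (@generated_sigma_coord _ _ _ _ [set q | q.1 = n]).
Qed.

Lemma measurable_present_innovation s i :
  measurable_fun [set: U] (innovation n s i : U -> R).
Proof.
rewrite (_ : innovation _ _ _ = fun w : U =>
  \sum_(q <- active n s i) (N q w)%:R - \sum_(q <- active n s i) rate q).
  by apply: measurable_funB => //; exact: measurable_present_sum.
by apply/funext => w; rewrite /innovation sumrB.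
Qed.

End present.

Lemma innovation_mean n s i : has_mean P (innovation n s i) 0.
Proof.
have := has_mean_sum (active n s i) (fun q => centered_mean noise_mean q).
by rewrite big1.
Qed.

Lemma innovation_sqr n s i :
  has_mean P (fun w => innovation n s i w ^+ 2) (\sum_(q <- active n s i) rate q).
Proof.
apply: centered_sum_sqr; last exact: active_uniq.
- exact: measurable_noise.
- exact: noise_indep.
- exact: noise_mean.
- exact: noise_centered_sqr.
Qed.

(** Distinct components draw on disjoint sets of independent sources. *)
Lemma innovation_orthogonal n s i j : i != j ->
  has_mean P (fun w => innovation n s i w * innovation n s j w) 0.
Proof.
move=> ij; apply: centered_sum_orthogonal.
- exact: measurable_noise.
- exact: noise_indep.
- exact: noise_mean.
- exact: noise_centered_sqr.
- move=> q /active_target qi; apply/negP => /active_target qj.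
  by move: ij; rewrite -qi -qj eqxx.
Qed.

(** * Integrability of the stationary solution *)

Hypothesis X_stationary : stationary P (fun n i => X n i : T -> nat).

Lemma stationary_functional (G : (int * 'I_d -> nat) -> R) n n' C :
  measurable_fun [set: path_space d] G -> measurable C ->
  P [set w | C (G (fun q => X (q.1 + n) q.2 w))] =
  P [set w | C (G (fun q => X (q.1 + n') q.2 w))].
Proof.
move=> mG mC.
by rewrite (stationary_law X_stationary n mG mC) (stationary_law X_stationary n' mG mC).
Qed.

Lemma measurable_X n i : measurable_fun [set: T] (fun w => (X n i w)%:R : R).
Proof. by apply: measurableT_comp => //; exact: measurable_funPT. Qed.

Section first_moment.
Variable h : 'cV[R]_d.
Hypothesis h_ge0 : forall i, 0 <= h i 0.
Hypothesis h_super : (\sum_k A k)^T *m h = h - const_mx 1.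

(* The vector b_k of the header; [A l] being the matrix at lag l.+1, the sum
   runs over [k <= l]. *)
Definition tail_weight (k : nat) (j : 'I_d) : R :=
  \sum_i h i 0 * \sum_(l < p | (k <= l)%N) A l i j.

Lemma tail_weight_ge0 k j : 0 <= tail_weight k j.
Proof.
by apply: sumr_ge0 => i _; rewrite mulr_ge0//; exact: sumr_ge0.
Qed.

(** The weight at 0 involves all lags, so it is h^T K; this is where superharmonicity of [h]
    enters. *)
Lemma tail_weight0 j : tail_weight 0 j = h j 0 - 1.
Proof.
have /matrixP/(_ j 0) := h_super; rewrite !mxE => <-; apply: eq_bigr => i _.
by rewrite mxE summxE mulrC.
Qed.

Lemma tail_weightS (k : 'I_p) j :
  tail_weight k j = \sum_i h i 0 * A k i j + tail_weight k.+1 j.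
Proof.
rewrite -big_split/=; apply: eq_bigr => i _; rewrite -mulrDr; congr (_ * _).
rewrite (bigD1 k)//=; congr (_ + _); apply: eq_bigl => l.
by rewrite ltn_neqAle eq_sym andbC.
Qed.

Lemma tail_weight_max j : tail_weight p j = 0.
Proof.
rewrite /tail_weight big1// => i _; rewrite big1 ?mulr0// => l.
by rewrite leqNgt ltn_ord.
Qed.

Let c := \sum_i h i 0 * a0 i 0.

Definition total n w : R := \sum_j (X n j w)%:R.

(** The V_n of the header. The last index gives weight b_p = 0, so the sum may run up to lag p. *)
Definition lyapunov n w : R := \sum_j h j 0 * (X n j w)%:R +
  \sum_(k < p) \sum_j tail_weight k.+1 j * (X (n - k.+1%:Z) j w)%:R.

(** The conditional mean of V_n given the past values [s]: averaging the noise turns the weight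
    b_(k+1) of [s k] into b_k. *)
Definition lyapunov_mean (s : nat -> 'I_d -> nat) : R :=
  c + \sum_(k < p) \sum_j tail_weight k j * (s k j)%:R.

Definition predicted_lyapunov n w := lyapunov_mean (lag (window n p w)).

Lemma predicted_lyapunovE n w : predicted_lyapunov n w =
  c + \sum_(k < p) \sum_j tail_weight k j * (X (n - k.+1%:Z) j w)%:R.
Proof.
congr (_ + _); apply: eq_bigr => k _; apply: eq_bigr => j _.
by rewrite lag_window.
Qed.

(** Both sides carry the same weights on older lags. At time n - 1 the weights are h and h - 1,
    which leaves the total as their difference. *)
Lemma lyapunov_predicted n w :
  lyapunov (n - 1) w = total (n - 1) w + predicted_lyapunov n w - c.
Proof.
pose f k := \sum_j tail_weight k j * (X (n - 1 - k%:Z) j w)%:R.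
have -> : predicted_lyapunov n w = c + \sum_(k < p) f k.
  rewrite predicted_lyapunovE; congr (_ + _); apply: eq_bigr => k _.
  apply: eq_bigr => j _; congr (_ * (X _ _ _)%:R).
  by rewrite -addn1 PoszD opprD; ring.
have -> : lyapunov (n - 1) w = total (n - 1) w + (f 0%N + \sum_(k < p) f k.+1).
  rewrite addrA; congr (_ + _); rewrite /total /f -big_split/=.
  by apply: eq_bigr => j _; rewrite subr0 tail_weight0; ring.
(* The extra last term [f p] vanishes with its weight. *)
have -> : f 0%N + \sum_(k < p) f k.+1 = \sum_(k < p) f k.
  rewrite -(big_ord_recl p (fun k => f k)) big_ord_recr/= [f p]big1 ?addr0// => j _.
  by rewrite tail_weight_max mul0r.
by ring.
Qed.

Lemma total_ge0 n w : 0 <= total n w.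
Proof. exact: sumr_ge0. Qed.

Lemma c_ge0 : 0 <= c.
Proof. by apply: sumr_ge0 => i _; rewrite mulr_ge0. Qed.

Lemma lyapunov_mean_ge0 s : 0 <= lyapunov_mean s.
Proof.
rewrite addr_ge0 ?c_ge0//; apply: sumr_ge0 => k _; apply: sumr_ge0 => j _.
by rewrite mulr_ge0// tail_weight_ge0.
Qed.

Lemma lyapunov_ge0 n w : 0 <= lyapunov n w.
Proof.
rewrite addr_ge0//; first by apply: sumr_ge0 => i _; rewrite mulr_ge0.
apply: sumr_ge0 => k _; apply: sumr_ge0 => j _.
by rewrite mulr_ge0// tail_weight_ge0.
Qed.

Lemma measurable_total n : measurable_fun [set: T] (total n).
Proof. by apply: measurable_fun_sum_seq => j _; exact: measurable_X. Qed.

Lemma measurable_lyapunov n : measurable_fun [set: T] (lyapunov n).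
Proof.
apply: measurable_funD.
  by apply: measurable_fun_sum_seq => j _; apply: measurable_funM => //; exact: measurable_X.
apply: measurable_fun_sum_seq => k _; apply: measurable_fun_sum_seq => j _.
by apply: measurable_funM => //; exact: measurable_X.
Qed.

Lemma measurable_predicted_lyapunov n :
  measurable_fun [set: T] (predicted_lyapunov n).
Proof.
rewrite (_ : predicted_lyapunov n = fun w => total (n - 1) w * -1 + lyapunov (n - 1) w + c).
  apply: measurable_funD => //; apply: measurable_funD; last exact: measurable_lyapunov.
  by apply: measurable_funM => //; exact: measurable_total.
by apply/funext => w; rewrite lyapunov_predicted; ring.
Qed.

Definition frozen_lyapunov n (s : nat -> 'I_d -> nat) w : R :=
  \sum_i h i 0 * \sum_(q <- active n s i) (N q w)%:R +
  \sum_(k < p) \sum_j tail_weight k.+1 j * (s k j)%:R.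

(** The coefficient of [s k j] is h^T A_(k+1) + b_(k+1) = b_k in the notation of the header. *)
Lemma frozen_lyapunov_mean n s :
  has_mean P (frozen_lyapunov n s) (lyapunov_mean s).
Proof.
rewrite [lyapunov_mean s](_ : _ = \sum_i h i 0 * \sum_(q <- active n s i) rate q +
  \sum_(k < p) \sum_j tail_weight k.+1 j * (s k j)%:R).
  apply: has_meanD; last exact: has_mean_cst.
  apply: has_mean_sum => i; apply: has_meanZ; apply: has_mean_sum => q.
  exact: noise_mean.
under [in RHS]eq_bigr do rewrite sum_active_rate mulrDr.
rewrite big_split/= -addrA; congr (_ + _).
under [in RHS]eq_bigr do rewrite mulr_sumr.
rewrite [X in _ = X + _]exchange_big -big_split/=; apply: eq_bigr => k _.
under [X in _ = X + _]eq_bigr do rewrite mulr_sumr.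
rewrite [X in _ = X + _]exchange_big -big_split/=; apply: eq_bigr => j _.
rewrite tail_weightS mulrDl mulr_suml; congr (_ + _).
by apply: eq_bigr => i _; rewrite mulrA.
Qed.

Lemma frozen_lyapunov_ge0 n s w : 0 <= frozen_lyapunov n s w.
Proof.
rewrite addr_ge0//.
  by apply: sumr_ge0 => i _; rewrite mulr_ge0//; exact: sumr_ge0.
apply: sumr_ge0 => k _; apply: sumr_ge0 => j _.
by rewrite mulr_ge0// tail_weight_ge0.
Qed.

Lemma ae_frozen_lyapunov n :
  {ae P, forall w, lyapunov n w = frozen_lyapunov n (lag (window n p w)) w}.
Proof.
apply: filterS (ae_active n (leqnn p)) => w Xw; congr (_ + _).
  by apply: eq_bigr => i _; rewrite Xw.
by apply: eq_bigr => k _; apply: eq_bigr => j _; rewrite lag_window.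
Qed.

Lemma frozen_lyapunov_adapted n s (phi : R -> R) : measurable_fun [set: R] phi ->
  adapted (present n) (fun w => phi (frozen_lyapunov n s w)).
Proof.
move=> mphi; apply: measurable_fun_adapted.
apply: (measurableT_comp mphi); apply: measurable_funD => //.
apply: measurable_fun_sum_seq => i _; apply: measurable_funM => //.
exact: measurable_present_sum.
Qed.

(** Conditional Jensen for the concave map min(., M). Truncation keeps everything integrable while
    no moment of [X] is known yet. *)
Lemma lyapunov_drift n (M : R) : 0 <= M ->
  (\int[P]_w (Num.min (lyapunov n w) M)%:E <=
   \int[P]_w (Num.min (predicted_lyapunov n w) M)%:E)%E.
Proof.
move=> M0.
have mmin : measurable_fun [set: R] (fun x => Num.min x M).
  exact: measurable_minr.
have mf z : measurable_fun [set: T] (frozen_lyapunov n (lag z)).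
  exact: has_mean_measurable (frozen_lyapunov_mean n (lag z)).
have f0 z w : 0 <= Num.min (frozen_lyapunov n (lag z) w) M.
  by rewrite le_min frozen_lyapunov_ge0.
pose a z := fine (\int[P]_w (Num.min (frozen_lyapunov n (lag z) w) M)%:E).
have fa z : has_mean P (fun w => Num.min (frozen_lyapunov n (lag z) w) M) (a z).
  apply: (@has_mean_bounded _ _ _ P _ M); first exact: (measurableT_comp mmin).
  by move=> w; rewrite f0 ge_min lexx orbT.
have a_ge0 z : 0 <= a z.
  by apply: fine_ge0; apply: integral_ge0 => w _; rewrite lee_fin.
(* Jensen reduces to the two bounds min(x, M) <= x and min(x, M) <= M. *)
have a_le z : a z <= Num.min (lyapunov_mean (lag z)) M.
  rewrite le_min; apply/andP; split.
    apply: has_mean_le (fa z) (frozen_lyapunov_mean n (lag z)) => w.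
    by rewrite ge_min lexx.
  by apply: has_mean_le (fa z) (has_mean_cst P M) => w; rewrite ge_min lexx orbT.
rewrite (ge0_integral_freeze (@present_measurable n) (@past_measurable n)
  (@noise_past n) (@window_past n p)
  (fun z => @frozen_lyapunov_adapted n (lag z) _ mmin) fa) => //.
- apply: ge0_le_integral => //.
  + by move=> w _; rewrite lee_fin.
  + apply/measurable_EFinP; apply: (measurable_fun_fibers (Z := window n p)).
    by move=> z; apply: (@past_measurable n); exact: window_past.
  + exact/measurable_EFinP/(measurableT_comp mmin (measurable_predicted_lyapunov n)).
  + by move=> w _; rewrite lee_fin.
- by apply: filterS (ae_frozen_lyapunov n) => w ->.
- exact: (measurableT_comp mmin (measurable_lyapunov _)).
- by move=> w; rewrite le_min lyapunov_ge0.
Qed.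

Lemma lyapunov_min_stationary n n' (M : R) : 0 <= M ->
  (\int[P]_w (Num.min (lyapunov n w) M)%:E =
   \int[P]_w (Num.min (lyapunov n' w) M)%:E)%E.
Proof.
move=> M0; have mmin : measurable_fun [set: R] (fun x => Num.min x M).
  exact: measurable_minr.
apply: ge0_integral_eq_law.
- exact: (measurableT_comp mmin (measurable_lyapunov _)).
- exact: (measurableT_comp mmin (measurable_lyapunov _)).
- move=> C mC.
  (* [G] reads the truncated V_0 off a path; on the path shifted by m it gives the truncated V_m. *)
  pose G (x : int * 'I_d -> nat) : R := Num.min (\sum_j h j 0 * (x (0, j))%:R +
    \sum_(k < p) \sum_j tail_weight k.+1 j * (x (- k.+1%:Z, j))%:R) M.
  have GE m w : G (fun q => X (q.1 + m) q.2 w) = Num.min (lyapunov m w) M.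
    congr (Num.min (_ + _) _).
      by apply: eq_bigr => j _; rewrite add0r.
    by apply: eq_bigr => k _; apply: eq_bigr => j _; rewrite addrC.
  have E m : (fun w => Num.min (lyapunov m w) M) @^-1` C =
      [set w | C (G (fun q => X (q.1 + m) q.2 w))].
    by apply/funext => w /=; rewrite GE.
  rewrite !E; apply: stationary_functional => //; apply: (measurableT_comp mmin).
  have mcoord q : measurable_fun [set: path_space d] (fun x => (x q)%:R : R).
    apply: (@measurableT_comp _ _ _ _ _ _ (fun k : nat => k%:R : R)) => //.
    exact: measurable_path_coord.
  apply: measurable_funD.
    by apply: measurable_fun_sum_seq => j _; exact: measurable_funM.
  apply: measurable_fun_sum_seq => k _; apply: measurable_fun_sum_seq => j _.
  exact: measurable_funM.
- by move=> w; rewrite le_min lyapunov_ge0.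
- by move=> w; rewrite le_min lyapunov_ge0.
Qed.

(* On V <= M one has |X| + min(V + c - |X|, M) <= min(V, M) + c, and on V > M the
   same inequality without the term |X|. *)
Lemma truncated_total_le n (M : R) : 0 <= M ->
  (\int[P]_(w in [set w | lyapunov (n - 1) w <= M]%R) (total (n - 1) w)%:E <=
   c%:E)%E.
Proof.
move=> M0; have mmin : measurable_fun [set: R] (fun x => Num.min x M).
  exact: measurable_minr.
have mS : measurable [set w | lyapunov (n - 1) w <= M].
  rewrite -[X in measurable X]setTI.
  exact: (measurable_lyapunov (n - 1) measurableT (measurable_itv `]-oo, M])).
pose e w := \1_[set w | lyapunov (n - 1) w <= M] w * total (n - 1) w.
have me : measurable_fun [set: T] e.
  by apply: measurable_funM; [exact: measurable_indic|exact: measurable_total].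
have predicted_ge0 w : 0 <= predicted_lyapunov n w by exact: lyapunov_mean_ge0.
(* Where V <= M, the total is V + c minus the nonnegative prediction. *)
have e01 w : 0 <= e w <= M + c.
  rewrite /e indicE; case: (boolP (w \in _)) => [/set_mem/= Mw|_]; last first.
    by rewrite mul0r lexx addr_ge0// c_ge0.
  rewrite mul1r total_ge0/=; move: Mw; rewrite lyapunov_predicted.
  by have := predicted_ge0 w; lra.
have he := has_mean_bounded P me e01.
have hmin (f : T -> R) : measurable_fun [set: T] f -> (forall w, 0 <= f w) ->
    has_mean P (fun w => Num.min (f w) M) (fine (\int[P]_w (Num.min (f w) M)%:E)).
  move=> mf f0; apply: (@has_mean_bounded _ _ _ P _ M); first exact: (measurableT_comp mmin).
  by move=> w; rewrite le_min f0 M0 ge_min lexx orbT.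
have hu := hmin _ (measurable_predicted_lyapunov n) predicted_ge0.
have hv := hmin _ (measurable_lyapunov (n - 1)) (lyapunov_ge0 (n - 1)).
have pointwise w : e w + Num.min (predicted_lyapunov n w) M <=
    Num.min (lyapunov (n - 1) w) M + c.
  have := lyapunov_predicted n w; have := total_ge0 (n - 1) w.
  have := c_ge0; have := predicted_ge0 w; rewrite /e indicE.
  case: (boolP (w \in _)) => [/set_mem/= Mw|/negP Mw].
    rewrite (min_l Mw) mul1r; have : Num.min (predicted_lyapunov n w) M <= predicted_lyapunov n w.
      by rewrite ge_min lexx.
    by lra.
  have {}Mw : M < lyapunov (n - 1) w.
    by rewrite ltNge; apply/negP => Mw'; apply: Mw; rewrite inE.
  rewrite (min_r (ltW Mw)) mul0r; have : Num.min (predicted_lyapunov n w) M <= M.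
    by rewrite ge_min lexx orbT.
  by lra.
have euv := has_mean_le pointwise (has_meanD he hu) (has_meanD hv (has_mean_cst P c)).
(* Stationarity moves V from time n - 1 to time n, where the drift inequality applies; both
   truncated means are finite and cancel in [euv]. *)
have : fine (\int[P]_w (Num.min (lyapunov (n - 1) w) M)%:E) <=
       fine (\int[P]_w (Num.min (predicted_lyapunov n w) M)%:E).
  apply: fine_le.
  - by case: hv => hvi _; exact: (integrable_fin_num measurableT hvi).
  - by case: hu => hui _; exact: (integrable_fin_num measurableT hui).
  - by rewrite (lyapunov_min_stationary _ n)//; exact: lyapunov_drift.
move=> vu; apply: (@le_trans _ _ (fine (\int[P]_w (e w)%:E))%:E); last first.
  by rewrite lee_fin; lra.
case: he => ei _; rewrite fineK; last exact: (integrable_fin_num measurableT ei).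
rewrite (eq_integral (fun w => (e w)%:E)) => [|w wS].
  apply: ge0_subset_integral => //; first exact/measurable_EFinP.
  by move=> w _; rewrite lee_fin; have /andP[] := e01 w.
by rewrite /e indicE wS mul1r.
Qed.

(** Monotone convergence: the bound [c] is uniform in the truncation level, and the sets where V <=
    k exhaust the space. *)
Lemma total_mean_le n : (\int[P]_w (total n w)%:E <= c%:E)%E.
Proof.
rewrite (_ : n = (n + 1) - 1); last by rewrite addrK.
pose S k := [set w | lyapunov (n + 1 - 1) w <= k%:R].
have mS k : measurable (S k).
  rewrite -[X in measurable X]setTI.
  exact: (measurable_lyapunov _ measurableT (measurable_itv `]-oo, k%:R])).
have US : \bigcup_k S k = setT.
  apply/seteqP; split => // w _; exists (Num.bound (lyapunov (n + 1 - 1) w)) => //=.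
  exact: ltW (archi_boundP (lyapunov_ge0 _ _)).
rewrite -US; have ndS : nondecreasing_seq S.
  move=> k l kl; apply/subsetPset => w /= /le_trans; apply.
  by rewrite ler_nat.
have mtotal : measurable_fun [set: T] (fun w => (total (n + 1 - 1) w)%:E).
  by apply/measurable_EFinP; exact: measurable_total.
have cvgS := @ge0_nondecreasing_set_cvg_integral _ _ _ S _ P ndS mS
  (fun k => measurable_funTS mtotal)
  (fun k w _ => total_ge0 (n + 1 - 1) w).
rewrite -(cvg_lim _ cvgS)//; apply: lime_le.
  by apply/cvg_ex; eexists; exact: cvgS.
by apply: nearW => k; exact: truncated_total_le.
Qed.

Lemma X_integrable n i : has_mean P (fun w => (X n i w)%:R)
  (fine (\int[P]_w (X n i w)%:R%:E)).
Proof.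
have Xfin : (\int[P]_w (X n i w)%:R%:E < +oo)%E.
  apply: le_lt_trans (ltry c); apply: le_trans (total_mean_le n).
  apply: ge0_le_integral => //.
  - by apply/measurable_EFinP; exact: measurable_X.
  - by apply/measurable_EFinP; exact: measurable_total.
  - move=> w _; rewrite lee_fin /total (bigD1 i)//= lerDl.
    exact: sumr_ge0.
apply: ge0_has_mean => //; first exact: measurable_X.
by rewrite fineK// ge0_fin_numE//; apply: integral_ge0 => w _; rewrite lee_fin.
Qed.

End first_moment.

(** * Second-order structure *)

Lemma X_integral_stationary n n' i :
  (\int[P]_w (X n i w)%:R%:E = \int[P]_w (X n' i w)%:R%:E :> \bar R)%E.
Proof.
apply: ge0_integral_eq_law => //; try exact: measurable_X.
move=> C mC.
have := @stationary_functional (fun x => (x (0, i))%:R) n n' C.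
rewrite /= !add0r; apply => //.
apply: (@measurableT_comp _ _ _ _ _ _ (fun k : nat => k%:R : R)) => //.
exact: measurable_path_coord.
Qed.

Lemma measurable_predictor n i : measurable_fun [set: T] (predictor n i).
Proof.
apply: measurable_funD => //; apply: measurable_fun_sum_seq => k _.
apply: measurable_fun_sum_seq => j _; apply: measurable_funM => //.
exact: measurable_X.
Qed.

Lemma measurable_residual n i :
  measurable_fun [set: T] (fun w => residual a0 A X n w i 0).
Proof.
rewrite (_ : (fun w => _) = fun w => (X n i w)%:R - predictor n i w).
  by apply: measurable_funB; [exact: measurable_X|exact: measurable_predictor].
by apply/funext => w; rewrite residualE.
Qed.

(** The residuals are the image of the path of [X] under a fixed measurable map [Phi] that commutes
    with time shifts. *)
Lemma residual_stationary : stationary P (fun n i w => residual a0 A X n w i 0).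
Proof.
move=> h B mB.
pose Phi (x : int * 'I_d -> nat) (q : int * 'I_d) : R := (x q)%:R -
  (a0 q.2 0 + \sum_(k < p) \sum_j A k q.2 j * (x (q.1 - k.+1%:Z, j))%:R).
have PhiE m w : Phi (fun q => X (q.1 + m) q.2 w) =
    fun q => residual a0 A X (q.1 + m) w q.2 0.
  apply/funext => q; rewrite residualE /Phi /predictor; congr (_ - (_ + _)).
  by apply: eq_bigr => k _; apply: eq_bigr => j _; rewrite /= addrAC.
have mPhi : measurable_fun [set: path_space d]
    (Phi : _ -> g_sigma_algebraType (\bigcup_(q in setT)
      preimage_set_system setT (fun f : int * 'I_d -> R => f q) measurable)).
  (* Preimages of the generating coordinate events suffice. *)
  apply: measurability => //.
  move=> _ [_ [q _ [C mC <-]] <-]; rewrite setTI.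
  suff mq : measurable_fun [set: path_space d] (fun x => Phi x q).
    by have := mq measurableT C mC; rewrite !setTI.
  have mcoord q' : measurable_fun [set: path_space d] (fun x => (x q')%:R : R).
    apply: (@measurableT_comp _ _ _ _ _ _ (fun k : nat => k%:R : R)) => //.
    exact: measurable_path_coord.
  apply: measurable_funB => //; apply: measurable_funD => //.
  apply: measurable_fun_sum_seq => k _; apply: measurable_fun_sum_seq => j _.
  exact: measurable_funM.
have := stationary_law X_stationary h mPhi mB.
rewrite (_ : [set w | B (Phi _)] =
  [set w | B (fun q => residual a0 A X (q.1 + h) w q.2 0)]); last first.
  by apply/funext => w /=; rewrite PhiE.
move=> ->; congr (P _); apply/funext => w /=.
have := PhiE 0 w; under eq_fun do rewrite addr0; move=> ->.
by under [in LHS]eq_fun do rewrite addr0.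
Qed.

Section second_order.
Variable m : 'cV[R]_d.
Hypothesis X_mean : forall n i, has_mean P (fun w => (X n i w)%:R) (m i 0).

Lemma predictor_mean n i :
  has_mean P (predictor n i) (a0 i 0 + \sum_(k < p) \sum_j A k i j * m j 0).
Proof.
apply: has_meanD; first exact: has_mean_cst.
apply: has_mean_sum => k; apply: has_mean_sum => j.
exact: has_meanZ.
Qed.

(** The Poisson variance equals the rate, so the conditional second moment is the predictor, whose
    mean is finite by [X_mean]. *)
Lemma residual_second_moment n i :
  has_mean P (fun w => residual a0 A X n w i 0 ^+ 2)
    (a0 i 0 + \sum_(k < p) \sum_j A k i j * m j 0).
Proof.
have msqr : measurable_fun [set: R] (fun x : R => x ^+ 2) by exact: measurable_funX.
apply: ge0_has_mean.
- exact: (measurableT_comp msqr (measurable_residual n i)).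
- by move=> w; exact: sqr_ge0.
have adapt z : adapted (present n) (fun w => innovation n (lag z) i w ^+ 2).
  apply: measurable_fun_adapted; apply: (measurableT_comp msqr).
  exact: measurable_present_innovation.
rewrite (ge0_integral_freeze (@present_measurable n) (@past_measurable n)
  (@noise_past n) (@window_past n p) adapt
  (fun z => innovation_sqr n (lag z) i)).
- have [_ <-] := predictor_mean n i; apply: eq_integral => w _.
  by rewrite (predictor_window _ _ _ (leqnn p)).
- by apply: filterS (ae_residual n (leqnn p)) => w ->.
- exact: (measurableT_comp msqr (measurable_residual n i)).
- by move=> w; exact: sqr_ge0.
- by move=> z w; exact: sqr_ge0.
- by move=> z; apply: sumr_ge0 => q _; exact: noise_rate_ge0.
Qed.

Lemma residual_mul_integrable n n' i j :
  P.-integrable [set: T]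
    (EFin \o (fun w => residual a0 A X n w i 0 * residual a0 A X n' w j 0)).
Proof.
apply: integrable_mul_sqr; try exact: measurable_residual.
- by case: (residual_second_moment n i).
- by case: (residual_second_moment n' j).
Qed.

Lemma residual_mean n i : has_mean P (fun w => residual a0 A X n w i 0) 0.
Proof.
apply: (has_mean_freeze0 (@present_measurable n) (@past_measurable n)
  (@noise_past n) (@window_past n p)
  (f := fun z => innovation n (lag z) i) (a := fun=> 0)) => //.
- by move=> z; apply: measurable_fun_adapted; exact: measurable_present_innovation.
- by move=> z; exact: innovation_mean.
- by apply: filterS (ae_residual n (leqnn p)) => w ->.
- apply: integrable_sqr; first exact: measurable_residual.
  by case: (residual_second_moment n i).
Qed.

(** [X] is the residual, of mean 0, plus the predictor. As [m] is the same at all times, this is a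
    linear system for [m]. *)
Lemma mean_equation i : m i 0 = a0 i 0 + \sum_(k < p) \sum_j A k i j * m j 0.
Proof.
have := has_meanD (residual_mean 0 i) (predictor_mean 0 i); rewrite add0r.
rewrite (_ : (fun w => _) = fun w => (X 0 i w)%:R).
  exact: has_mean_inj.
by apply/funext => w; rewrite residualE subrK.
Qed.

Lemma residual_variance n i :
  has_mean P (fun w => residual a0 A X n w i 0 * residual a0 A X n w i 0) (m i 0).
Proof. by rewrite mean_equation; exact: residual_second_moment. Qed.

Lemma residual_orthogonal n i j : i != j ->
  has_mean P (fun w => residual a0 A X n w i 0 * residual a0 A X n w j 0) 0.
Proof.
move=> ij; apply: (has_mean_freeze0 (@present_measurable n) (@past_measurable n)
  (@noise_past n) (@window_past n p)
  (f := fun z w => innovation n (lag z) i w * innovation n (lag z) j w)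
  (a := fun=> 0)) => //.
- move=> z; apply: measurable_fun_adapted.
  by apply: measurable_funM; exact: measurable_present_innovation.
- by move=> z; exact: innovation_orthogonal.
- by apply: filterS (ae_residual n (leqnn p)) => w uw; rewrite !uw.
- exact: residual_mul_integrable.
Qed.

Lemma residual_past_orthogonal n (k : nat) i j :
  has_mean P (fun w => residual a0 A X n w i 0 *
                       residual a0 A X (n - k.+1%:Z) w j 0) 0.
Proof.
(* The oldest state in the residual at time n - k - 1 is that at time n - (k + 1 + p). *)
pose L := (k + p).+1.
have pL : (p <= L)%N by rewrite /L -addSn leq_addl.
pose v (z : seq {ffun 'I_d -> nat}) : R := (lag z k j)%:R - (a0 j 0 +
  \sum_(l < p) \sum_j' A l j j' * (lag z (k + l.+1) j')%:R).
have vE w : residual a0 A X (n - k.+1%:Z) w j 0 = v (window n L w).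
  rewrite residualE /predictor /v lag_window ?ltnS ?leq_addr//.
  congr (_ - (_ + _)); apply: eq_bigr => l _; apply: eq_bigr => j' _.
  rewrite lag_window; last by rewrite /L ltnS leq_add2l.
  by rewrite -addSn PoszD opprD addrA.
apply: (has_mean_freeze0 (@present_measurable n) (@past_measurable n)
  (@noise_past n) (@window_past n L)
  (f := fun z w => v z * innovation n (lag z) i w) (a := fun=> 0)) => //.
- move=> z; apply: measurable_fun_adapted.
  by apply: measurable_funM => //; exact: measurable_present_innovation.
- by move=> z; rewrite -[0](mulr0 (v z)); apply: has_meanZ; exact: innovation_mean.
- by apply: filterS (ae_residual n pL) => w uw; rewrite uw vE mulrC.
- exact: residual_mul_integrable.
Qed.

Lemma residual_covariance n n' i j :
  has_mean P (fun w => residual a0 A X n w i 0 * residual a0 A X n' w j 0)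
    (if (n == n') && (i == j) then m i 0 else 0).
Proof.
have [->|nn'] := eqVneq n n' => /=.
  by have [->|ij] := eqVneq i j; [exact: residual_variance|exact: residual_orthogonal].
have [lt_n|le_n] := ltP n' n.
  (* A gap of g >= 1 corresponds to index g - 1. *)
  have -> : n' = n - (`|n - n'|%N.-1).+1%:Z.
    by rewrite prednK; lia.
  exact: residual_past_orthogonal.
under eq_fun do rewrite mulrC.
have -> : n = n' - (`|n' - n|%N.-1).+1%:Z.
  by rewrite prednK; lia.
exact: residual_past_orthogonal.
Qed.

End second_order.
End inar_theory.

(** * From means to the white-noise statement *)

Lemma has_mean_expectation {disp : measure_display} {T : measurableType disp}
    {R : realType} (P : probability T R) (f : T -> R) (a : R) :
  has_mean P f a -> expectation P f = a%:E.
Proof. by move=> [_ fa]; rewrite unlock. Qed.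

Theorem proposition3p1 (disp : measure_display) (T : measurableType disp)
    (R : realType) (P : probability T R) (d p : nat)
    (a0 : 'cV[R]_d) (A : 'I_p -> 'M[R]_d)
    (X : int -> 'I_d -> {RV P >-> nat})
    (d_gt0 : (0 < d)%N) (p_gt0 : (0 < p)%N)
    (a0_ge0 : forall i, 0 <= a0 i 0) (a0_neq0 : a0 != 0)
    (A_ge0 : forall k i j, 0 <= A k i j)
    (X_INAR : is_INAR a0 A X)
    (zeros_in_disk : forall z : complex R,
      \det (z%:M - map_mx (real_complex R) (\sum_(k < p) A k)) = 0 ->
      `|z| < 1) :
  white_noise P (residual a0 A X)
    (diag_mx (invmx (1%:M - \sum_(k < p) A k) *m a0)^T).
Proof.
have [X_stat [eps [xi [eps_law xi_law indep past recursion]]]] := X_INAR.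
pose K := \sum_(k < p) A k.
have K0 i j : 0 <= K i j by rewrite /K summxE; exact: sumr_ge0.
have detK := det_sub_scale_neq0 zeros_in_disk.
(* The row relation h^T K = h^T - 1^T is the superharmonic equation for the transpose. *)
have [|t t01|h [h0 hK]] := @exists_superharmonic R d K^T.
- by move=> i j; rewrite mxE.
- by rewrite -linearZ/= -[1%:M]trmx1 -linearB/= det_tr detK.
(* The mean at time 0, which stationarity carries to all times. *)
pose m : 'cV[R]_d := \col_i fine (\int[P]_w (X 0 i w)%:R%:E).
have X_mean n i : has_mean P (fun w => (X n i w)%:R) (m i 0).
  rewrite mxE (X_integral_stationary X_stat 0 n).
  exact: (X_integrable a0_ge0 A_ge0 eps_law xi_law past recursion X_stat h0 hK).
(* The mean equation reads (1 - K) m = a_0, and 1 - K is invertible by the case t = 1 of [detK]. *)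
have -> : invmx (1%:M - K) *m a0 = m.
  have Ku : 1%:M - K \in unitmx.
    by rewrite unitmxE unitfE -[K]scale1r detK// ler01 lexx.
  apply: (can_inj (mulKmx Ku)); rewrite mulKVmx//.
  apply/matrixP => i j; rewrite ord1 mulmxBl mul1mx [RHS]mxE.
  rewrite [in RHS](mean_equation a0_ge0 A_ge0 eps_law xi_law indep past recursion X_mean).
  rewrite mxE -addrA [X in _ + X](_ : _ = 0) ?addr0//.
  apply/eqP; rewrite subr_eq0; apply/eqP.
  rewrite mxE exchange_big/=; apply: eq_bigr => j' _.
  by rewrite /K summxE mulr_suml.
have cov := residual_covariance a0_ge0 A_ge0 eps_law xi_law indep past recursion X_mean.
have mean := residual_mean a0_ge0 A_ge0 eps_law xi_law indep past recursion X_mean.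
split.
- exact: residual_stationary.
- by move=> n; apply/matrixP => i j; rewrite !mxE ord1; apply: has_mean_expectation.
- move=> n n'; apply/matrixP => i j; rewrite !mxE.
  rewrite (_ : (fun w => _) =
    fun w => residual a0 A X n w i 0 * residual a0 A X n' w j 0); last first.
    by apply/funext => w; rewrite mxE big_ord1 [_^T _ _]mxE.
  rewrite (has_mean_expectation (cov n n' i j)); congr EFin.
  by case: (n == n'); rewrite /= !mxE//; case: eqVneq => [->|]; rewrite ?mulr1n ?mulr0n.
Qed.
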